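(* For any symmetric generalised uniform space $(X,M)$, we have an isomorphism of formal topologies $\overline{\mathcal S_X}\cong\mathcal U(X)$, where $\overline{\mathcal S_X}$ is the completion of the uniform formal topology $(\mathcal S_X,\mathcal C_M)$. That is, the localic completion of a symmetric generalised uniform space is the point-free completion of the standard uniform formal topology induced by $M$. In particular, the localic completion of a symmetric generalised uniform space is complete as a uniform formal topology.
   Context: Foundations: constructive (Aczel's CZF with the Regular Extension Axiom; neither excluded middle nor choice is assumed). $\mathrm{Pow}(S)$ is the class of subsets of $S$. For a relation $r\subseteq S\times T$ and $D\subseteq T$, $r^-D=\{a\in S\mid \exists b\in D,\ a\,r\,b\}$ and $r^-b=r^-\{b\}$. Formal topologies: a formal topology is $\mathcal S=(S,\lhd,\le)$ with $(S,\le)$ a preordered set and $\lhd$ a relation between $S$ and $\mathrm{Pow}(S)$ (a cover) such that $\{a\mid a\lhd U\}$ is a set for each $U\subseteq S$ and, for all $a,b\in S$, $U,V\subseteq S$: (1) $U\lhd U$; (2) $a\lhd U$ and $U\lhd V$ imply $a\lhd V$; (3) $a\lhd U$ and $a\lhd V$ imply $a\lhd U\downarrow V$; (4) $a\le b$ implies $a\lhd b$. Here $U\lhd V$ means $\forall a\in U\ (a\lhd V)$, $U\downarrow V=\{c\mid\exists a\in U\,\exists b\in V\ (c\le a,\ c\le b)\}$, and singletons are written as elements. A formal topology map $r\colon\mathcal S\to\mathcal S'$ is a relation $r\subseteq S\times S'$ with $S\lhd r^-S'$; $r^-a\downarrow r^-b\lhd r^-(a\downarrow' b)$; $a\lhd'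 U\Rightarrow r^-a\lhd r^-U$. Two maps $r,s$ are equal if $r^-a\lhd s^-a$ and $s^-a\lhd r^-a$ for all $a\in S'$. Composition is composition of relations, the identity is the equality relation; isomorphism is meant in this category. The cover inductively generated on a preorder by given axioms $a\lhd C$ is the least cover (making the preorder a formal topology) that satisfies the axioms. $\mathcal S$ is overt if there is a (necessarily unique) positivity $\mathrm{Pos}\subseteq S$: it is splitting ($a\in\mathrm{Pos}$, $a\lhd U$ imply $\mathrm{Pos}\cap U$ inhabited) and $a\lhd\{x\in S\mid x=a,\ x\in\mathrm{Pos}\}$ for all $a$. $\mathrm{Pos}(W)$ for a subset $W$ means that $W$ contains an element of $\mathrm{Pos}$. Uniform formal topologies: let $\mathcal S$ be overt. $C\subseteq S$ is a cover of $\mathcal S$ if $S\lhd C$. For covers $C,C'$: $C\leqslant C'$ iff $\forall a\in C\,\exists a'\in C'\ (a\lhd a')$; $St_C(a)=\{b\in C\mid\mathrm{Pos}(b\downarrow a)\}$; $C<^*C'$ iff $\forall a\in C\,\exists a'\in C'\ (St_C(a)\lhd a')$. A uniformity on $\mathcal S$ is a set $\mathcal C$ of covers such that any two members have a common $\leqslant$-refinement in $\mathcal C$; for each $C\in\mathcal C$ there is $C'\in\mathcal C$ with $C'<^*C$; and $a\lhd\mathsf{uc}(a)$ for all $a\in S$, where $\mathsf{uc}(a)=\{b\in S\mid\exists C\in\mathcal C\ (St_C(b)\lhd a)\}$. A uniform formal topology is such a pair $(\mathcal S,\mathcal C)$. Its completion is $\overline{\mathcal S}=(S,\bar\lhd,\le)$,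 where $a\le b$ iff $a\lhd b$ and $\bar\lhd$ is inductively generated by: $a\,\bar\lhd\,\mathsf{uc}(a)$; $a\,\bar\lhd\,C$ for each $C\in\mathcal C$; $a\,\bar\lhd\,\{x\mid x=a,\ x\in\mathrm{Pos}\}$ (for all $a\in S$). $(\mathcal S,\mathcal C)$ is complete if the canonical map $\mathcal S\to\overline{\mathcal S}$ given by the identity relation on $S$ is an isomorphism, i.e. $a\lhd U\iff a\,\bar\lhd\,U$ for all $a,U$. Upper reals: $\mathbb R^u$ is the class of subsets $U\subseteq\mathbb Q^{>0}$ with $q\in U\iff\exists q'<q\,(q'\in U)$ (possibly empty). $U\le V$ iff $V\subseteq U$; $U+V=\{q_1+q_2\mid q_1\in U,q_2\in V\}$; a non-negative rational $r$ is identified with $\{q\mid r<q\}$; $U<V$ iff $U+r\le V$ for some $r\in\mathbb Q^{>0}$ (so $U<q\iff q\in U$). Generalised uniform spaces: a generalised metric on $X$ is $d\colon X\times X\to\mathbb R^u$ with $d(x,x)=0$ and $d(x,z)\le d(x,y)+d(y,z)$; generalised metrics are ordered pointwise; $d$ is symmetric if $d(x,y)=d(y,x)$. A generalised uniform space (gus) is $(X,M)$ with $M$ a set of generalised metrics on $X$ that is inhabited and closed under binary sups; it is symmetric if each $d\in M$ is. Localic completion: for a gus $(X,M)$ let $U_X=M\times\mathbb Q^{>0}\times X$, with elements written $\mathsf b_d(x,\varepsilon)$. Put $\mathsf b_d(y,\delta)\le_X\mathsf b_\rho(x,\varepsilon)$ iff $\rho\le d$ and $\rho(x,y)+\delta\le\varepsilon$;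 and $\mathsf b_d(y,\delta)<_X\mathsf b_\rho(x,\varepsilon)$ iff $\rho\le d$ and $\rho(x,y)+\delta<\varepsilon$. $\mathcal U(X)=(U_X,\lhd_X,\le_X)$ where $\lhd_X$ is inductively generated by the axioms, for all $a\in U_X$: (U1) $a\lhd_X\{b\mid b<_Xa\}$; (U2) $a\lhd_X\mathcal C_d^\varepsilon$ for each $d\in M$, $\varepsilon\in\mathbb Q^{>0}$, where $\mathcal C_d^\varepsilon=\{\mathsf b_d(x,\varepsilon)\mid x\in X\}$. Its positivity is $U_X$. The standard uniform formal topology $(\mathcal S_X,\mathcal C_M)$: put $\mathsf b_d(x,\varepsilon)_*=\{x'\in X\mid d(x,x')<\varepsilon\}$ and $U_*=\bigcup_{a\in U}a_*$. Then $\mathcal S_X=(U_X,\lhd_X^*,\preceq_X)$ with $a\preceq_Xb$ iff $a_*\subseteq b_*$ and $a\lhd_X^*U$ iff $a_*\subseteq U_*$ (positivity $U_X$), and $\mathcal C_M=\{\mathcal C_d^\varepsilon\mid d\in M,\ \varepsilon\in\mathbb Q^{>0}\}$. The localic completion $\mathcal U(X)$ is regarded as a uniform formal topology with the same uniformity $\{\mathcal C_d^\varepsilon\mid d\in M,\ \varepsilon\in\mathbb Q^{>0}\}$. *)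

(* Defs.v *)
From mathcomp Require Import all_boot all_order all_algebra.
From mathcomp Require Import interval_inference classical_sets lra.

Set Implicit Arguments.
Unset Strict Implicit.
Unset Printing Implicit Defensive.

Import Order.TTheory GRing.Theory Num.Theory.

Local Open Scope classical_set_scope.
Local Open Scope ring_scope.

(** Subsets are [set T := T -> Prop]; no classical axiom is used anywhere in
    this file. *)

Section Covers.
Variables (T : Type) (le : T -> T -> Prop) (cov : T -> set T -> Prop).

Definition down (U V : set T) : set T :=
  [set c | exists a b, [/\ U a, V b, le c a & le c b]].

Definition setcov (U V : set T) : Prop := forall a, U a -> cov a V.

Record preorder_rel : Prop := PreorderRel {
  pre_refl : forall a, le a a;
  pre_trans : forall a b c, le a b -> le b c -> le a c }.

Record cover_rel : Prop := CoverRel {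
  cov_refl : forall U, setcov U U;
  cov_trans : forall a U V, cov a U -> setcov U V -> cov a V;
  cov_down : forall a U V, cov a U -> cov a V -> cov a (down U V);
  cov_le : forall a b, le a b -> cov a [set b] }.

End Covers.

Record formal_topology : Type := FormalTopology {
  ft_car :> Type;
  ft_le : ft_car -> ft_car -> Prop;
  ft_cov : ft_car -> set ft_car -> Prop;
  ft_pre : preorder_rel ft_le;
  ft_covP : cover_rel ft_le ft_cov }.

Definition ft_down (S : formal_topology) (U V : set S) : set S :=
  down (@ft_le S) U V.
Definition ft_setcov (S : formal_topology) (U V : set S) : Prop :=
  setcov (@ft_cov S) U V.

(** The cover inductively generated by the axioms [a <| C] with [A a C]. *)
Section Generated.
Variables (T : Type) (le : T -> T -> Prop) (A : T -> set T -> Prop).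

Inductive gen_cov : T -> set T -> Prop :=
| gen_ax a C : A a C -> gen_cov a C
| gen_refl (a : T) (U : set T) : U a -> gen_cov a U
| gen_trans a (U V : set T) :
    gen_cov a U -> (forall b, U b -> gen_cov b V) -> gen_cov a V
| gen_down a U V : gen_cov a U -> gen_cov a V -> gen_cov a (down le U V)
| gen_le a b : le a b -> gen_cov a [set b].

Lemma gen_cov_cover : cover_rel le gen_cov.
Proof.
split.
- by move=> U a; exact: gen_refl.
- by move=> a U V aU UV; exact: gen_trans aU UV.
- by move=> a U V; exact: gen_down.
- by move=> a b; exact: gen_le.
Qed.

Lemma gen_cov_least (cov : T -> set T -> Prop) :
  cover_rel le cov -> (forall a C, A a C -> cov a C) ->
  forall a U, gen_cov a U -> cov a U.
Proof.
move=> covP covA a U; elim=> {a U}.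
- exact: covA.
- by move=> a U Ua; exact: (cov_refl covP).
- by move=> a U V _ aU _ UV; exact: (cov_trans covP) aU UV.
- by move=> a U V _ aU _ aV; exact: (cov_down covP).
- by move=> a b; exact: (cov_le covP).
Qed.

End Generated.

Definition gen_ft (T : Type) (le : T -> T -> Prop) (A : T -> set T -> Prop)
    (leP : preorder_rel le) : formal_topology :=
  FormalTopology leP (gen_cov_cover le A).

Definition relpre (S T : Type) (r : S -> T -> Prop) (D : set T) : set S :=
  [set a | exists2 b, D b & r a b].

Record is_ft_map (S T : formal_topology) (r : S -> T -> Prop) : Prop := IsFtMap {
  ftm_total : ft_setcov setT (relpre r setT);
  ftm_down : forall a b : T,
    ft_setcov (ft_down (relpre r [set a]) (relpre r [set b]))
              (relpre r (ft_down [set a] [set b]));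
  ftm_cov : forall (a : T) (U : set T),
    ft_cov a U -> ft_setcov (relpre r [set a]) (relpre r U) }.

Record ft_map (S T : formal_topology) : Type := FtMap {
  ftm_rel :> S -> T -> Prop;
  ftm_is_map : is_ft_map ftm_rel }.

Definition ft_map_eq (S T : formal_topology) (r s : ft_map S T) : Prop :=
  forall a : T, ft_setcov (relpre r [set a]) (relpre s [set a]) /\
                ft_setcov (relpre s [set a]) (relpre r [set a]).

Section CoverFacts.
Variable S : formal_topology.
Implicit Types (a b : S) (U V : set S).

Lemma ft_refl U a : U a -> ft_cov a U.
Proof. exact: (cov_refl (ft_covP S)). Qed.

Lemma ft_trans U a V : ft_cov a U -> ft_setcov U V -> ft_cov a V.
Proof. exact: (cov_trans (ft_covP S)). Qed.

Lemma ft_sub U a V : ft_cov a U -> U `<=` V -> ft_cov a V.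
Proof. by move=> aU UV; apply: ft_trans aU _ => b /UV; exact: ft_refl. Qed.

Lemma ft_le_cov a b V : ft_le a b -> ft_cov b V -> ft_cov a V.
Proof.
move=> ab bV; apply: ft_trans (cov_le (ft_covP S) ab) _.
by move=> _ ->.
Qed.

End CoverFacts.

Lemma ftm_setcov (S T : formal_topology) (r : S -> T -> Prop) (U V : set T) :
  is_ft_map r -> ft_setcov U V -> ft_setcov (relpre r U) (relpre r V).
Proof.
move=> rP UV a [b Ub rab]; apply: (ftm_cov rP (UV _ Ub)).
by exists b.
Qed.

Definition eq_rel (T : Type) : T -> T -> Prop := fun a b => a = b.

Lemma is_ft_map_id (S : formal_topology) : is_ft_map (@eq_rel S : S -> S -> Prop).
Proof.
split.
- by move=> a _; apply: ft_refl; exists a.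
- move=> a b c [_ [_ [[_ -> ->] [_ -> ->] ca cb]]]; apply: ft_refl.
  by exists c => //; exists a, b.
- move=> a U aU _ [_ -> ->]; apply: ft_sub aU _ => b Ub.
  by exists b.
Qed.

Definition ft_id (S : formal_topology) : ft_map S S := FtMap (is_ft_map_id S).

Definition rel_comp (S T W : Type) (s : T -> W -> Prop) (r : S -> T -> Prop) :
  S -> W -> Prop := fun a c => exists2 b, r a b & s b c.

Lemma is_ft_map_comp (S T W : formal_topology) (s : T -> W -> Prop)
    (r : S -> T -> Prop) :
  is_ft_map s -> is_ft_map r -> is_ft_map (rel_comp s r).
Proof.
move=> sP rP.
have sub U : relpre r (relpre s U) `<=` relpre (rel_comp s r) U.
  by move=> a [b [c Uc sbc] rab]; exists c => //; exists b.
split.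
- move=> a _; apply: (ft_trans (ftm_total rP (a := a) I)) => b [c _ rbc].
  have cov : ft_setcov [set c] (relpre s setT) by move=> c' _; exact: (ftm_total sP).
  apply: ft_sub (@sub setT); apply: (ftm_setcov rP cov).
  by exists c.
- move=> a b c [x [y [[_ -> [u ru ua]] [_ -> [v rv vb]] cx cy]]].
  apply: ft_sub (sub _).
  have cuv : ft_cov c (relpre r (ft_down [set u] [set v])).
    apply: (ftm_down rP (a := u) (b := v)).
    by exists x, y; split=> //; [exists u | exists v].
  apply: ft_trans cuv _; apply: ftm_setcov => // w [_ [_ [-> -> wu wv]]].
  apply: (ftm_down sP); exists u, v.
  by split=> //; [exists a | exists b].
- move=> a U aU x [_ -> [u xu ua]].
  apply: ft_sub (sub _).
  apply: (ftm_setcov rP (ftm_cov sP aU)).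
  by exists u => //; exists a.
Qed.

Definition ft_comp (S T W : formal_topology) (s : ft_map T W) (r : ft_map S T) :
  ft_map S W := FtMap (is_ft_map_comp (ftm_is_map s) (ftm_is_map r)).

Definition ft_is_iso (S T : formal_topology) (r : ft_map S T) : Prop :=
  exists s : ft_map T S,
    ft_map_eq (ft_comp s r) (ft_id S) /\ ft_map_eq (ft_comp r s) (ft_id T).

Definition ft_isomorphic (S T : formal_topology) : Prop :=
  exists r : ft_map S T, ft_is_iso r.

Record is_positivity (S : formal_topology) (Pos : set S) : Prop := IsPositivity {
  pos_splitting : forall (a : S) (U : set S),
    Pos a -> ft_cov a U -> Pos `&` U !=set0;
  pos_cov : forall a : S, ft_cov a [set x | x = a /\ Pos x] }.

Section Uniformity.
Variables (S : formal_topology) (Pos : set S).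

Definition is_cover (C : set S) : Prop := ft_setcov setT C.

Definition cover_refines (C C' : set S) : Prop :=
  forall a, C a -> exists2 a', C' a' & ft_cov a [set a'].

Definition star (C : set S) (a : S) : set S :=
  [set b | C b /\ Pos `&` ft_down [set b] [set a] !=set0].

Definition star_refines (C C' : set S) : Prop :=
  forall a, C a -> exists2 a', C' a' & ft_setcov (star C a) [set a'].

Definition uc (Unif : set (set S)) (a : S) : set S :=
  [set b | exists2 C, Unif C & ft_setcov (star C b) [set a]].

Record is_uniformity (Unif : set (set S)) : Prop := IsUniformity {
  unif_cover : forall C, Unif C -> is_cover C;
  unif_refine : forall C1 C2, Unif C1 -> Unif C2 ->
    exists C, [/\ Unif C, cover_refines C C1 & cover_refines C C2];
  unif_star : forall C, Unif C -> exists2 C', Unif C' & star_refines C' C;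
  unif_uc : forall a, ft_cov a (uc Unif a) }.

End Uniformity.

Record uniform_ft : Type := UniformFt {
  uft_ft :> formal_topology;
  uft_pos : set uft_ft;
  uft_unif : set (set uft_ft);
  uft_posP : is_positivity uft_pos;
  uft_unifP : is_uniformity uft_pos uft_unif }.

Section Completion.
Variable S : uniform_ft.

Inductive completion_axiom : S -> set S -> Prop :=
| compl_uc a : completion_axiom a (uc (@uft_pos S) (@uft_unif S) a)
| compl_unif a C : uft_unif C -> completion_axiom a C
| compl_pos a : completion_axiom a [set x | x = a /\ uft_pos x].

Definition completion_le (a b : S) : Prop := ft_cov a [set b].

Lemma completion_le_pre : preorder_rel completion_le.
Proof.
split; first by move=> a; exact: ft_refl.
by move=> a b c ab bc; apply: ft_trans ab _ => _ ->.
Qed.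

Definition completion : formal_topology :=
  gen_ft completion_axiom completion_le_pre.

Lemma completion_cov_sub (a : S) (U : set S) :
  ft_cov (f := completion) a U -> ft_cov a U.
Proof.
move: a U; apply: gen_cov_least.
- split.
  + by move=> U a; exact: ft_refl.
  + by move=> a U V; exact: ft_trans.
  + move=> a U V aU aV.
    apply: ft_sub (cov_down (ft_covP S) aU aV) _.
    move=> c [u [v [Uu Vv cu cv]]]; exists u, v.
    by split=> //; exact: (cov_le (ft_covP S)).
  + by [].
- move=> a C [{}a|{}a {}C UC|{}a].
  + exact: (unif_uc (uft_unifP S)).
  + exact: (unif_cover (uft_unifP S) UC).
  + exact: (pos_cov (uft_posP S)).
Qed.

Lemma is_ft_map_canonical :
  @is_ft_map S completion (@eq_rel S : S -> completion -> Prop).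
Proof.
split.
- by move=> a _; apply: ft_refl; exists a.
- move=> a b c [_ [_ [[_ -> ->] [_ -> ->] ca cb]]]; apply: ft_refl.
  exists c => //; exists a, b.
  by split=> //; exact: (cov_le (ft_covP S)).
- move=> a U /completion_cov_sub aU _ [_ -> ->]; apply: ft_sub aU _ => b Ub.
  by exists b.
Qed.

Definition completion_map : ft_map S completion := FtMap is_ft_map_canonical.

Definition complete : Prop := ft_is_iso completion_map.

Lemma completeP :
  complete <-> (forall (a : S) (U : set S),
                  ft_cov a U <-> ft_cov (f := completion) a U).
Proof.
split=> [[s [_ eqs]] a U|covE].
  split; last exact: completion_cov_sub.
  move=> aU; have sP := ftm_is_map s.
  have rpE (V : set S) :
      relpre (ft_comp completion_map s) V `<=` relpre s V /\
      relpre s V `<=` relpre (ft_comp completion_map s) V.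
    split=> x; first by move=> [b Vb [c sxc cb]]; exists b => //; rewrite -cb.
    by move=> [b Vb sxb]; exists b => //; exists b.
  have [_ h1] := eqs a.
  have as_ : ft_cov (f := completion) a (relpre s [set a]).
    apply: (@ft_sub completion) (proj1 (rpE _)); apply: h1.
    by exists a.
  apply: (ft_trans as_) => x xa.
  apply: (ft_trans (ftm_cov sP aU xa)) => y [u Uu syu].
  have [h2 _] := eqs u.
  apply: (@ft_sub completion [set u]); last by move=> _ ->.
  have yu : ft_cov (f := completion) y (relpre (ft_id completion) [set u]).
    by apply: h2; apply: (proj2 (rpE _)); exists u.
  by apply: (ft_trans yu) => _ [_ -> ->]; exact: (@ft_refl completion).
have sP : @is_ft_map completion S (@eq_rel S : completion -> S -> Prop).
  split.
  - by move=> a _; apply: ft_refl; exists a.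
  - move=> a b c [_ [_ [[_ -> ->] [_ -> ->] ca cb]]].
    apply/covE; have := cov_down (ft_covP S) ca cb => h.
    by apply: ft_sub h _ => d [_ [_ [-> -> da db]]]; exists d => //; exists a, b.
  - move=> a U /covE aU _ [_ -> ->]; apply: ft_sub aU _ => b Ub.
    by exists b.
exists (FtMap sP); split=> a; split.
- by move=> _ [_ -> [_ -> ->]]; apply: ft_refl; exists a.
- by move=> _ [_ -> ->]; apply: ft_refl; exists a => //; exists a.
- by move=> _ [_ -> [_ -> ->]]; apply: ft_refl; exists a.
- by move=> _ [_ -> ->]; apply: ft_refl; exists a => //; exists a.
Qed.

End Completion.

(** Non-negative upper reals, possibly empty (the empty one is infinity).
    Positivity of [q'] in [ur_rounded] is implied by [ur_pos]. *)
Record upper_real : Type := UpperReal {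
  ur_set :> rat -> Prop;
  ur_pos : forall q, ur_set q -> 0 < q;
  ur_rounded : forall q, ur_set q <-> exists2 q', q' < q & ur_set q' }.

Definition ur_le (U V : upper_real) : Prop := ur_set V `<=` ur_set U.

(** Equality of upper reals is extensional equality of subsets. *)
Definition ur_eq (U V : upper_real) : Prop := forall q, U q <-> V q.

Definition ur_add_set (U V : set rat) : set rat :=
  [set q | exists q1 q2, [/\ U q1, V q2 & q = q1 + q2]].

Lemma ur_add_pos (U V : upper_real) q : ur_add_set U V q -> 0 < q.
Proof. by move=> [q1 [q2 [/ur_pos q10 /ur_pos q20 ->]]]; rewrite addr_gt0. Qed.

Lemma ur_up (U : upper_real) (p q : rat) : p <= q -> U p -> U q.
Proof.
rewrite le_eqVlt => /orP[/eqP -> //|pq Up].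
by apply/ur_rounded; exists p.
Qed.

Lemma ur_add_rounded (U V : upper_real) q :
  ur_add_set U V q <-> exists2 q', q' < q & ur_add_set U V q'.
Proof.
split.
- move=> [q1 [q2 [/ur_rounded[q1' lt1 U1] V2 ->]]].
  by exists (q1' + q2); [rewrite ltrD2r | exists q1', q2].
- move=> [q' lt [q1 [q2 [U1 V2 q'E]]]].
  exists (q1 + (q - q')), q2; split=> //; last by rewrite q'E; lra.
  by apply: ur_up U1; lra.
Qed.

Definition ur_add (U V : upper_real) : upper_real :=
  UpperReal (@ur_add_pos U V) (@ur_add_rounded U V).

Section OfRat.
Variable r : {nonneg rat}.

Lemma ur_of_rat_pos q : [set q | r%:num < q] q -> 0 < q.
Proof. by apply: le_lt_trans. Qed.

Lemma ur_of_rat_rounded q : [set q | r%:num < q] q <->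
  exists2 q', q' < q & [set q | r%:num < q] q'.
Proof.
split=> /= [rq|[q' q'q rq']]; last exact: lt_trans q'q.
by exists ((r%:num + q) / 2); lra.
Qed.

Definition ur_of_rat : upper_real := UpperReal ur_of_rat_pos ur_of_rat_rounded.

End OfRat.

Definition ur_of_pos (r : {posnum rat}) : upper_real := ur_of_rat (r%:num)%:nng.

Definition ur_lt (U V : upper_real) : Prop :=
  exists r : {posnum rat}, ur_le (ur_add U (ur_of_pos r)) V.

Lemma ur_lt_posP (U : upper_real) (e : {posnum rat}) :
  ur_lt U (ur_of_pos e) <-> U e%:num.
Proof.
split=> [[r h]|/ur_rounded[q qe Uq]].
  have [|q1 [q2 [U1 /= r2 E]]] := h (e%:num + r%:num); first by rewrite /= ltrDl.
  by apply: ur_up U1; lra.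
have eq0 : 0 < e%:num - q by rewrite subr_gt0.
exists (PosNum eq0) => p /= ep; exists q, (p - q); split=> //=; last by lra.
by rewrite ltrD2r.
Qed.

Lemma ur_add_leP (U : upper_real) (d e : {posnum rat}) :
  ur_le (ur_add U (ur_of_pos d)) (ur_of_pos e) <->
  forall q, e%:num < q -> U (q - d%:num).
Proof.
split=> h q eq.
  have [q1 [q2 [U1 /= d2 E]]] := h q eq.
  by apply: ur_up U1; lra.
have /ur_rounded[p pq Up] := h q eq.
by exists p, (q - p); split=> //=; lra.
Qed.

Lemma ur_add_ltP (U : upper_real) (d e : {posnum rat}) :
  ur_lt (ur_add U (ur_of_pos d)) (ur_of_pos e) <-> U (e%:num - d%:num).
Proof.
split=> [/ur_lt_posP[q1 [q2 [U1 /= d2 E]]]|/ur_rounded[p pq Up]].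
  by apply: ur_up U1; lra.
apply/ur_lt_posP; exists p, (e%:num - p); split=> //=; lra.
Qed.

Record gen_metric (X : Type) : Type := GenMetric {
  gm_dist :> X -> X -> upper_real;
  gm_refl : forall x, ur_eq (gm_dist x x) (ur_of_rat 0%:nng);
  gm_triangle : forall x y z,
    ur_le (gm_dist x z) (ur_add (gm_dist x y) (gm_dist y z)) }.

Definition gm_le (X : Type) (d e : gen_metric X) : Prop :=
  forall x y, ur_le (d x y) (e x y).

Definition gm_is_sup (X : Type) (d e s : gen_metric X) : Prop :=
  [/\ gm_le d s, gm_le e s &
      forall t : gen_metric X, gm_le d t -> gm_le e t -> gm_le s t].

Definition gm_symmetric (X : Type) (d : gen_metric X) : Prop :=
  forall x y, ur_eq (d x y) (d y x).

Record gus : Type := Gus {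
  gus_car :> Type;
  gus_metrics : set (gen_metric gus_car);
  gus_inhabited : gus_metrics !=set0;
  gus_sup : forall d e, gus_metrics d -> gus_metrics e ->
    exists2 s, gus_metrics s & gm_is_sup d e s }.

Definition gus_symmetric (X : gus) : Prop :=
  forall d, @gus_metrics X d -> gm_symmetric d.

Definition gus_metric (X : gus) : Type := {d : gen_metric X | gus_metrics d}.

Record ball (X : gus) : Type := Ball {
  ball_metric : gus_metric X;
  ball_radius : {posnum rat};
  ball_center : X }.

Section Balls.
Variable X : gus.
Implicit Types (a b : ball X) (d : gus_metric X) (e : {posnum rat}).

Definition ball_dist a : gen_metric X := sval (ball_metric a).

Definition ball_le b a : Prop :=
  gm_le (ball_dist a) (ball_dist b) /\
  ur_le (ur_add (ball_dist a (ball_center a) (ball_center b))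
                (ur_of_pos (ball_radius b)))
        (ur_of_pos (ball_radius a)).

Definition ball_lt b a : Prop :=
  gm_le (ball_dist a) (ball_dist b) /\
  ur_lt (ur_add (ball_dist a (ball_center a) (ball_center b))
                (ur_of_pos (ball_radius b)))
        (ur_of_pos (ball_radius a)).

Definition ball_cover d e : set (ball X) := [set Ball d e x | x in setT].

Definition ball_covers : set (set (ball X)) :=
  [set C | exists d e, C = ball_cover d e].

Definition ball_pts a : set X :=
  [set x | ur_lt (ball_dist a (ball_center a) x) (ur_of_pos (ball_radius a))].

Definition balls_pts (U : set (ball X)) : set X := \bigcup_(a in U) ball_pts a.

Inductive localic_axiom : ball X -> set (ball X) -> Prop :=
| localic_U1 a : localic_axiom a [set b | ball_lt b a]
| localic_U2 a d e : localic_axiom a (ball_cover d e).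

Lemma gm_lexx (T : Type) (d : gen_metric T) : gm_le d d.
Proof. by move=> x y q. Qed.

Lemma gm_tri (d : gen_metric X) x y z p q :
  d x y p -> d y z q -> d x z (p + q).
Proof. by move=> dp dq; apply: (gm_triangle (x := x) (y := y)); exists p, q. Qed.

Lemma gm_diag (d : gen_metric X) x q : 0 < q -> d x x q.
Proof. by move=> q0; apply/gm_refl. Qed.

Lemma ball_le_pre : preorder_rel ball_le.
Proof.
split=> [a|a b c [ab1 /ur_add_leP ab2] [bc1 /ur_add_leP bc2]].
  split; first exact: gm_lexx.
  apply/ur_add_leP => q eq.
  by apply: gm_diag; rewrite subr_gt0.
split=> [x y q /ab1 /bc1 //|]; apply/ur_add_leP => q cq.
have /ur_rounded[p pq bp] := bc2 q cq.
have /ab2/bc1 abp : (ball_radius b)%:num < q - p by lra.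
by have := gm_tri bp abp; congr (gm_dist _ _ _ _); lra.
Qed.

Definition localic_completion : formal_topology :=
  gen_ft localic_axiom ball_le_pre.

Definition std_le a b : Prop := ball_pts a `<=` ball_pts b.
Definition std_cov a (U : set (ball X)) : Prop := ball_pts a `<=` balls_pts U.

Lemma ball_ptsP a x :
  ball_pts a x <-> ball_dist a (ball_center a) x (ball_radius a)%:num.
Proof. exact: ur_lt_posP. Qed.

Lemma ball_le_std a b : ball_le a b -> std_le a b.
Proof.
move=> [ab1 /ur_add_leP ab2] x /ball_ptsP /ur_rounded[p pa /ab1 ap].
apply/ball_ptsP.
have {}ab2 : ball_dist b (ball_center b) (ball_center a)
    ((ball_radius b)%:num + ((ball_radius a)%:num - p) - (ball_radius a)%:num).
  by apply: ab2; rewrite ltrDl subr_gt0.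
by have := gm_tri ab2 ap; congr (gm_dist _ _ _ _); lra.
Qed.

Lemma ball_center_pts a : ball_pts a (ball_center a).
Proof. by apply/ball_ptsP; apply: gm_diag. Qed.

Lemma ball_meet a b x : ball_pts a x -> ball_pts b x ->
  exists c, [/\ ball_pts c x, ball_le c a & ball_le c b].
Proof.
move=> /ball_ptsP /ur_rounded[p pa ap] /ball_ptsP /ur_rounded[q qb bq].
have [s Ms [as_ bs _]] :=
  gus_sup (svalP (ball_metric a)) (svalP (ball_metric b)).
have r0 : 0 < Num.min ((ball_radius a)%:num - p) ((ball_radius b)%:num - q).
  by rewrite lt_min !subr_gt0 pa qb.
have rp : Num.min ((ball_radius a)%:num - p) ((ball_radius b)%:num - q) <=
  (ball_radius a)%:num - p by rewrite ge_min lexx.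
have rq : Num.min ((ball_radius a)%:num - p) ((ball_radius b)%:num - q) <=
  (ball_radius b)%:num - q by rewrite ge_min lexx orbT.
exists (Ball (exist _ s Ms) (PosNum r0) x); split.
- exact: ball_center_pts.
- by split=> //; apply/ur_add_leP => t /= t0; apply: ur_up ap; lra.
- by split=> //; apply/ur_add_leP => t /= t0; apply: ur_up bq; lra.
Qed.

Lemma std_le_pre : preorder_rel std_le.
Proof. by split=> [a x //|a b c ab bc x /ab /bc]. Qed.

(** Used for both [ball_le] and [std_le]. *)
Lemma std_cov_cover (le : ball X -> ball X -> Prop) :
  (forall a b, ball_le a b -> le a b) -> (forall a b, le a b -> std_le a b) ->
  cover_rel le std_cov.
Proof.
move=> leI leE; split.
- by move=> U a Ua x ax; exists a.
- by move=> a U V aU UV x /aU[b /UV]; exact.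
- move=> a U V aU aV x ax.
  have [u Uu ux] := aU x ax; have [v Vv vx] := aV x ax.
  have [c [cx cu cv]] := ball_meet ux vx.
  by exists c => //; exists u, v; split=> //; apply: leI.
- by move=> a b /leE ab x /ab bx; exists b.
Qed.

Definition std_ft : formal_topology :=
  FormalTopology std_le_pre (std_cov_cover ball_le_std (fun _ _ h => h)).

Lemma std_cover_in a d e : std_cov a (ball_cover d e).
Proof.
by move=> x _; exists (Ball d e x); [exists x | exact: ball_center_pts].
Qed.

Lemma localic_cov_std a (U : set (ball X)) :
  ft_cov (f := localic_completion) a U -> std_cov a U.
Proof.
move: a U; apply: gen_cov_least.
  by apply: std_cov_cover => // a b; exact: ball_le_std.
move=> a C [{}a|{}a d e]; last exact: std_cover_in.
move=> x /ball_ptsP ax; have /ur_rounded[p pa ap] := ax.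
have r0 : 0 < ((ball_radius a)%:num - p) / 2 by rewrite divr_gt0 // subr_gt0.
exists (Ball (ball_metric a) (PosNum r0) x); last exact: ball_center_pts.
split; first exact: gm_lexx.
apply/ur_add_ltP => /=.
by apply: ur_up ap; lra.
Qed.

Lemma std_positivity : is_positivity (S := std_ft) setT.
Proof.
split=> [a U _ aU|a].
  by have [u Uu _] := aU _ (ball_center_pts a); exists u.
by apply: ft_refl.
Qed.

Lemma localic_positivity : is_positivity (S := localic_completion) setT.
Proof.
split=> [a U _ /localic_cov_std aU|a].
  by have [u Uu _] := aU _ (ball_center_pts a); exists u.
by apply: ft_refl.
Qed.

Hypothesis symX : gus_symmetric X.

Section UniformityFacts.
Variables (le : ball X -> ball X -> Prop) (cov : ball X -> set (ball X) -> Prop).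
Hypotheses (leP : preorder_rel le) (covP : cover_rel le cov).
Hypotheses (le_std : forall a b, le a b -> std_le a b).
Hypotheses (le_cov : forall a b, ball_le a b -> cov a [set b]).
Hypotheses (cov_U1 : forall a, cov a [set b | ball_lt b a]).
Hypotheses (cov_U2 : forall a d e, cov a (ball_cover d e)).

Let S : formal_topology := FormalTopology leP covP.

Lemma ball_star (C : set (ball X)) a b :
  star (S := S) setT C a b -> C b /\ exists z, ball_pts b z /\ ball_pts a z.
Proof.
move=> [Cb [c [_ [_ [_ [-> -> /le_std cb /le_std ca]]]]]]; split=> //.
by exists (ball_center c); split; [apply: cb|apply: ca]; exact: ball_center_pts.
Qed.

Lemma ball_near d e1 e2 x y z p :
  sval d x z p -> sval d y z e1%:num -> p + e1%:num + e1%:num <= e2%:num ->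
  ball_le (Ball d e1 y) (Ball d e2 x).
Proof.
move=> xz /(symX (svalP d)) zy pe; split; first exact: gm_lexx.
apply/ur_add_leP => q /= q0.
by apply: ur_up (gm_tri xz zy); lra.
Qed.

Lemma ball_uniformity : is_uniformity (S := S) setT ball_covers.
Proof.
split.
- by move=> _ [d [e ->]] a _; exact: cov_U2.
- move=> _ _ [d1 [e1 ->]] [d2 [e2 ->]].
  have [s Ms [d1s d2s _]] := gus_sup (svalP d1) (svalP d2).
  have r0 : 0 < Num.min e1%:num e2%:num by rewrite lt_min !gt0.
  have r1 : Num.min e1%:num e2%:num <= e1%:num by rewrite ge_min lexx.
  have r2 : Num.min e1%:num e2%:num <= e2%:num by rewrite ge_min lexx orbT.
  exists (ball_cover (exist _ s Ms) (PosNum r0)); split.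
  + by exists (exist _ s Ms), (PosNum r0).
  + move=> _ [x _ <-]; exists (Ball d1 e1 x); first by exists x.
    apply: le_cov; split=> //; apply/ur_add_leP => t /= t0.
    by apply: gm_diag; lra.
  + move=> _ [x _ <-]; exists (Ball d2 e2 x); first by exists x.
    apply: le_cov; split=> //; apply/ur_add_leP => t /= t0.
    by apply: gm_diag; lra.
- move=> _ [d [e ->]].
  have e0 : 0 < e%:num / 3 by rewrite divr_gt0.
  exists (ball_cover d (PosNum e0)); first by exists d, (PosNum e0).
  move=> _ [x _ <-]; exists (Ball d e x); first by exists x.
  move=> b /ball_star[[y _ <-] [z [/ball_ptsP yz /ball_ptsP xz]]].
  by apply: le_cov; apply: (ball_near xz yz) => /=; lra.
- move=> [d e x]; apply: (cov_trans covP (cov_U1 _)) => b [ab lt_ba].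
  have /ur_rounded[p pe abp] := proj1 (ur_add_ltP _ _ _) lt_ba; apply: (cov_refl covP).
  have e0 : 0 < (e%:num - (ball_radius b)%:num - p) / 2.
    by rewrite divr_gt0 // subr_gt0.
  exists (ball_cover d (PosNum e0)).
    by exists d, (PosNum e0).
  move=> c /ball_star[[w _ <-] [z [/ball_ptsP wz /ball_ptsP /ab bz]]].
  by apply: le_cov; apply: (ball_near (gm_tri abp bz) wz) => /=; lra.
Qed.

End UniformityFacts.

Lemma std_uniformity : is_uniformity (S := std_ft) setT ball_covers.
Proof.
apply: ball_uniformity => //.
- by move=> a b /ball_le_std ab x /ab bx; exists b.
- by move=> a; apply: localic_cov_std; apply: gen_ax; exact: localic_U1.
- exact: std_cover_in.
Qed.

Lemma localic_uniformity :
  is_uniformity (S := localic_completion) setT ball_covers.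
Proof.
apply: ball_uniformity.
- exact: ball_le_std.
- by move=> a b; exact: gen_le.
- by move=> a; apply: gen_ax; exact: localic_U1.
- by move=> a d e; apply: gen_ax; exact: localic_U2.
Qed.

Definition std_uft : uniform_ft := UniformFt std_positivity std_uniformity.

Definition localic_uft : uniform_ft :=
  UniformFt localic_positivity localic_uniformity.

End Balls.

(* Main.v *)
From mathcomp Require Import all_boot all_order all_algebra.
From mathcomp Require Import interval_inference classical_sets lra.
Require Import Defs.

(** The isomorphism is not the identity relation: in the completion of the
    standard uniform topology a ball is identified with every ball having the
    same points of [X], which fails in the localic completion.  The two maps are
    [a < b] from the completion to the localic completion, and [a \in uc b] in
    the other direction.  Both are understood through small balls: every ball is
    covered, in either topology, by the balls of [C_d^e] meeting it, and when
    [b < a] all sufficiently small balls meeting [b] are again [< a].  This turns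
    inclusions between sets of points into the formal relation [<]. *)

Set Implicit Arguments.
Unset Strict Implicit.
Unset Printing Implicit Defensive.

Import Order.TTheory GRing.Theory Num.Theory.

Local Open Scope classical_set_scope.
Local Open Scope ring_scope.

(** * Positive radii and the two orders on balls *)

Lemma posnum_half (e : {posnum rat}) :
  exists h : {posnum rat}, h%:num + h%:num = e%:num.
Proof.
have h0 : 0 < e%:num / 2 by rewrite divr_gt0.
by exists (PosNum h0) => /=; lra.
Qed.

Lemma posnum_lb (e1 e2 : {posnum rat}) :
  exists e : {posnum rat}, e%:num <= e1%:num /\ e%:num <= e2%:num.
Proof.
have e0 : 0 < Num.min e1%:num e2%:num by rewrite lt_min !gt0.
by exists (PosNum e0); split; rewrite /= ge_min lexx ?orbT.
Qed.

Section BallOrder.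
Variable X : gus.
Implicit Types (a b c u v w : ball X) (d : gus_metric X) (e : {posnum rat}).

Lemma gus_metric_ub d1 d2 :
  exists d, gm_le (sval d1) (sval d) /\ gm_le (sval d2) (sval d).
Proof.
have [s Ms [d1s d2s _]] := gus_sup (svalP d1) (svalP d2).
by exists (exist _ s Ms).
Qed.

Lemma ball_ltP b a :
  ball_lt b a <-> gm_le (ball_dist a) (ball_dist b) /\
    ball_dist a (ball_center a) (ball_center b)
      ((ball_radius a)%:num - (ball_radius b)%:num).
Proof. by split=> -[le_ab /ur_add_ltP lt_ba]; split=> //; apply/ur_add_ltP. Qed.

Lemma ball_ltW b a : ball_lt b a -> ball_le b a.
Proof.
move=> /ball_ltP[le_ab lt_ba]; split=> //; apply/ur_add_leP => q aq.
by apply: ur_up lt_ba; lra.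
Qed.

Lemma ball_lt_le_trans a b c : ball_lt a b -> ball_le b c -> ball_lt a c.
Proof.
move=> /ball_ltP[le_ba /ur_rounded[p pb bp]] [le_cb /ur_add_leP le_bc].
apply/ball_ltP; split=> [x y q /le_ba /le_cb //|].
(* [b <= c] bounds the distance only at rationals strictly beyond the difference of radii; the gap
   that roundedness leaves above [p] provides the excess. *)
have cp : ball_dist c (ball_center c) (ball_center b)
    ((ball_radius c)%:num - (ball_radius a)%:num - p).
  have -> : (ball_radius c)%:num - (ball_radius a)%:num - p =
    ((ball_radius c)%:num + ((ball_radius b)%:num - (ball_radius a)%:num - p))
      - (ball_radius b)%:num by lra.
  by apply: le_bc; rewrite ltrDl subr_gt0.
have := gm_tri cp (le_cb _ _ _ bp); apply: ur_up; lra.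
Qed.

Lemma ball_lt_concentric d e1 e2 (x : X) :
  e1%:num < e2%:num -> ball_lt (Ball d e1 x) (Ball d e2 x).
Proof.
move=> lt12; apply/ball_ltP; split; first exact: gm_lexx.
by apply: gm_diag; rewrite subr_gt0.
Qed.

Lemma ball_le_center d1 d2 e1 e2 (x : X) :
  gm_le (sval d2) (sval d1) -> e1%:num <= e2%:num ->
  ball_le (Ball d1 e1 x) (Ball d2 e2 x).
Proof.
move=> led le12; split=> //; apply/ur_add_leP => q eq /=.
by apply: gm_diag; rewrite subr_gt0; apply: le_lt_trans eq.
Qed.

(** Enlarge [b] concentrically: roundedness gives a distance bound [p] such that the radius of [b]
    is below that of [a] minus [p], and the mean of these two numbers is a suitable radius. *)
Lemma ball_lt_interpolate b a : ball_lt b a -> exists2 c, ball_lt b c & ball_lt c a.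
Proof.
case: b => d e x /ball_ltP[/= le_ab /ur_rounded[p pa ap]].
have e0 : 0 < e%:num by [].
have eh : e%:num < ((ball_radius a)%:num - p + e%:num) / 2 by lra.
have h0 := lt_trans e0 eh.
exists (Ball d (PosNum h0) x); first exact: ball_lt_concentric.
by apply/ball_ltP; split=> //=; apply: ur_up ap; lra.
Qed.

Definition meets a b : Prop := ball_pts a `&` ball_pts b !=set0.

Hypothesis symX : gus_symmetric X.

(** The triangle inequality runs from the centre of [a] to that of [b], to a common point, to [x];
    symmetry of the metric reverses the last leg. The bound [e] is uniform in [d] and [x], so it
    applies to whole covers. *)
Lemma small_meets_lt b a : ball_lt b a ->
  exists e, forall d e' (x : X), gm_le (ball_dist b) (sval d) ->
    e'%:num <= e%:num -> meets (Ball d e' x) b -> ball_lt (Ball d e' x) a.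
Proof.
move=> /ball_ltP[le_ab /ur_rounded[p pa ap]].
(* Half of the slack, because the small radius counts twice: as distance to the common point and as
   radius. *)
have h0 : 0 < ((ball_radius a)%:num - (ball_radius b)%:num - p) / 2.
  by rewrite divr_gt0 // subr_gt0.
exists (PosNum h0) => d e' x le_bd /= le_e [z [/ball_ptsP /= xz /ball_ptsP bz]].
apply/ball_ltP; split=> [y y' q /le_bd /le_ab //|] /=.
move/(symX (svalP d)): xz => /le_bd /le_ab zx.
have := gm_tri (gm_tri ap (le_ab _ _ _ bz)) zx; apply: ur_up; lra.
Qed.

Lemma ball_concentric_meets d e1 e2 e3 (x y : X) :
  e1%:num + e3%:num + e3%:num <= e2%:num ->
  meets (Ball d e3 y) (Ball d e1 x) -> ball_le (Ball d e3 y) (Ball d e2 x).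
Proof.
move=> le_e [z [/ball_ptsP yz /ball_ptsP xz]].
exact: (ball_near symX xz yz).
Qed.

End BallOrder.

(** * Formal topologies on balls whose order respects points and which satisfy (U2) *)

Section BallTopology.
Variables (X : gus) (symX : gus_symmetric X).
Variables (le : ball X -> ball X -> Prop) (cov : ball X -> set (ball X) -> Prop).
Hypotheses (leP : preorder_rel le) (covP : cover_rel le cov).
Hypothesis le_std : forall a b, le a b -> std_le a b.
Hypothesis cov_U2 : forall a d e, cov a (ball_cover d e).
Implicit Types (a b c u v w : ball X) (d : gus_metric X) (e : {posnum rat}).

Let F : formal_topology := FormalTopology leP covP.

(** Intersect [a] with the uniform cover: the centre of a ball below both is a common point, so only
    members meeting [a] contribute. *)
Lemma cov_small a d e :
  cov a [set c | exists2 x, c = Ball d e x & meets c a].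
Proof.
have a_a : cov a [set a] by apply: (cov_refl covP).
apply: (cov_trans covP (cov_down covP a_a (cov_U2 a d e))).
move=> f [_ [_ [-> [x _ <-] fa fx]]].
apply: (@ft_sub F) (cov_le covP fx) _ => _ ->.
exists x => //; exists (ball_center f).
by split; [apply: (le_std fx)|apply: (le_std fa)]; exact: ball_center_pts.
Qed.

(** Only the points of [c] matter: a small ball meeting [c] meets [u'] and [v'], hence is formally
    below [u] and [v]. *)
Lemma cov_meet_lt c u v u' v' : std_le c u' -> std_le c v' ->
  ball_lt u' u -> ball_lt v' v ->
  cov c (relpre (@ball_lt X) (down (@ball_le X) [set u] [set v])).
Proof.
move=> cu' cv' uu vv.
have [e1 eu] := small_meets_lt symX uu; have [e2 ev] := small_meets_lt symX vv.
have [d [du dv]] := gus_metric_ub (ball_metric u') (ball_metric v').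
have [e [le1 le2]] := posnum_lb e1 e2; have [h hE] := posnum_half e.
(* The covering balls have radius [h], half of [e]; the concentric ball of radius [e] is the common
   lower bound they are [<]. *)
have he : h%:num < e%:num by rewrite -hE ltrDl.
apply: (@ft_sub F) (cov_small c d h) _ => _ [x -> [z [xz cz]]].
have xz' : ball_pts (Ball d e x) z.
  by apply: (ball_le_std _ xz); apply/ball_ltW/ball_lt_concentric.
exists (Ball d e x); last exact: ball_lt_concentric.
exists u, v; split=> //; apply: ball_ltW.
- by apply: eu => //; exists z; split=> //; apply: cu'.
- by apply: ev => //; exists z; split=> //; apply: cv'.
Qed.

(* A cover [a <| U] of the localic completion holds in [F] only after both sides
   are replaced by the balls [<] them; in this form it is stable under the
   generating rules. *)
Lemma is_ft_map_ball_lt : is_ft_map (S := F) (T := localic_completion X) (@ball_lt X).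
Proof.
have downE (a b : ball X) : ft_setcov (S := F)
    (down le (relpre (@ball_lt X) [set a]) (relpre (@ball_lt X) [set b]))
    (relpre (@ball_lt X) (down (@ball_le X) [set a] [set b])).
  move=> c [u [v [[_ -> ua] [_ -> vb] cu cv]]].
  exact: cov_meet_lt (le_std cu) (le_std cv) ua vb.
split=> //.
- move=> [d e x] _; have h0 : 0 < e%:num + e%:num by rewrite addr_gt0.
  apply: ft_refl; exists (Ball d (PosNum h0) x) => //.
  by apply: ball_lt_concentric; rewrite /= ltrDl.
- apply: (@gen_cov_least _ _ _ (fun a U => ft_setcov (S := F)
    (relpre (@ball_lt X) [set a]) (relpre (@ball_lt X) U))); first split.
  + by move=> U a Ua b [_ -> ba]; apply: ft_refl; exists a.
  + move=> a U V aU UV b ba; apply: ft_trans (aU b ba) _ => c [u Uu cu].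
    by apply: (UV u Uu); exists u.
  + move=> a U V aU aV b ba.
    apply: (cov_trans covP (cov_down covP (aU b ba) (aV b ba))).
    move=> c [u' [v' [[u Uu uu] [v Vv vv] cu cv]]].
    apply: (@ft_sub F) (downE u v c _) _.
      by exists u', v'; split=> //; [exists u|exists v].
    by move=> w [t [_ [_ [-> -> tu tv]]] wt]; exists t => //; exists u, v.
  + move=> a b ab c [_ -> ca]; apply: ft_refl; exists b => //.
    exact: ball_lt_le_trans ab.
  + move=> a C [{}a|{}a d e] b [_ -> ba].
      have [c bc ca] := ball_lt_interpolate ba.
      by apply: ft_refl; exists c.
    (* (U2): balls of half the radius are [<] the concentric members of the cover. *)
    have [h hE] := posnum_half e.
    apply: (@ft_sub F) (cov_small b d h) _ => _ [x -> _].
    exists (Ball d e x); first by exists x.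
    by apply: ball_lt_concentric; rewrite -hE ltrDl.
Qed.

End BallTopology.

(** * Uniform formal topologies on balls: the sets [uc] and the completion *)

Section BallUniform.
Variables (X : gus) (symX : gus_symmetric X).
Variables (le : ball X -> ball X -> Prop) (cov : ball X -> set (ball X) -> Prop).
Hypotheses (leP : preorder_rel le) (covP : cover_rel le cov).
Hypothesis ball_le_le : forall a b, ball_le a b -> le a b.
Hypothesis cov_std : forall a U, cov a U -> std_cov a U.
Implicit Types (a b c : ball X) (d : gus_metric X) (e : {posnum rat}).

Let F : formal_topology := FormalTopology leP covP.
Hypothesis posP : is_positivity (S := F) setT.
Hypothesis unifP : is_uniformity (S := F) setT (@ball_covers X).
Let S : uniform_ft := UniformFt posP unifP.

Lemma cov1_std a b : cov a [set b] -> std_le a b.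
Proof. by move=> /cov_std ab x /ab[_ ->]. Qed.

(** As all balls are positive, stars reduce to common points: [ball_meet] turns a common point into
    a lower bound, and the centre of a lower bound is a common point. *)
Lemma uc_ballP a b : uc (S := F) setT (@ball_covers X) a b <->
  exists d e, forall x, meets (Ball d e x) b -> cov (Ball d e x) [set a].
Proof.
split=> [[_ [d [e ->]] stE]|[d [e stE]]].
  exists d, e => x [z [xz bz]]; apply: stE; split; first by exists x.
  have [c [_ cx cb]] := ball_meet xz bz.
  by exists c; split=> //; exists (Ball d e x), b; split=> //; exact: ball_le_le.
exists (ball_cover d e); first by exists d, e.
move=> _ [[x _ <-] [c [_ [_ [_ [-> -> cx cb]]]]]]; apply: stE.
exists (ball_center c); split; apply: cov1_std (ball_center_pts c);
  exact: (cov_le covP).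
Qed.

Lemma completion_le_std a b : completion_le (S := S) a b -> std_le a b.
Proof. exact: cov1_std. Qed.

Lemma completion_U2 a d e : ft_cov (f := completion S) a (ball_cover d e).
Proof. by apply/gen_ax/compl_unif; exists d, e. Qed.

Lemma uc_cov a b : uc (S := F) setT (@ball_covers X) a b -> cov b [set a].
Proof.
move=> /uc_ballP[d [e he]].
have leF (u v : ball X) : le u v -> std_le u v.
  by move=> uv; apply/cov1_std/(cov_le covP).
have U2 (u : ball X) d' e' : cov u (ball_cover d' e').
  by apply: (unif_cover unifP) => //; exists d', e'.
apply: (cov_trans covP (cov_small leP covP leF U2 b d e)) => _ [x -> xb].
exact: he.
Qed.

Lemma completion_cov_small a d e : ft_cov (f := completion S) a
  [set c | exists2 x, c = Ball d e x & meets c a].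
Proof.
exact: (cov_small (ft_pre (completion S)) (ft_covP (completion S))
  completion_le_std completion_U2).
Qed.

Lemma is_ft_map_completion_lt :
  is_ft_map (S := completion S) (T := localic_completion X) (@ball_lt X).
Proof.
exact: (is_ft_map_ball_lt symX (ft_pre (completion S)) (ft_covP (completion S))
  completion_le_std completion_U2).
Qed.

Lemma ball_lt_uc a b : ball_lt a b -> uc (S := F) setT (@ball_covers X) b a.
Proof.
move=> ab; have [e he] := small_meets_lt symX ab.
apply/uc_ballP; exists (ball_metric a), e => x xa.
by apply/(cov_le covP)/ball_le_le/ball_ltW/he => //; exact: gm_lexx.
Qed.

Lemma small_meets_uc a b : uc (S := F) setT (@ball_covers X) a b ->
  exists d e h, h%:num < e%:num /\ forall x, meets (Ball d h x) b ->
    uc (S := F) setT (@ball_covers X) a (Ball d e x).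
Proof.
move=> /uc_ballP[d [e he]].
(* [e2] is a half and [e4] a quarter of [e], so [e2 + e4 + e4 = e]: an [e4]-ball meeting the
   [e2]-ball at [x] is below the [e]-ball at [x], which [a] covers. *)
have [e2 e2E] := posnum_half e; have [e4 e4E] := posnum_half e2.
have lt42 : e4%:num < e2%:num by rewrite -e4E ltrDl.
have lt4 : e4%:num < e%:num by apply: (lt_trans lt42); rewrite -e2E ltrDl.
exists d, e2, e4; split=> // x [z [xz bz]].
apply/uc_ballP; exists d, e4 => y yx.
have xa : cov (Ball d e x) [set a].
  apply: he; exists z; split=> //.
  by apply: (ball_le_std _ xz); apply/ball_ltW/ball_lt_concentric.
apply: (@ft_le_cov F) xa; apply/ball_le_le/(ball_concentric_meets symX _ yx).
by rewrite -addrA e4E e2E.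
Qed.

(** Sharpens the axiom for [uc a]: each member is covered by small balls whose concentric
    enlargements stay in [uc a]. It says that the identity is below the composite of the two maps on
    the completion. *)
Lemma completion_lt_uc a :
  ft_cov (f := completion S) a
    [set c | exists2 b, ball_lt c b & uc (S := F) setT (@ball_covers X) a b].
Proof.
have a_uc : ft_cov (f := completion S) a (uc (S := F) setT (@ball_covers X) a).
  exact/gen_ax/compl_uc.
apply: (ft_trans a_uc) => b /small_meets_uc[d [e [h [he hb]]]].
apply: (@ft_sub (completion S)) (completion_cov_small b d h) _.
move=> _ [x -> /hb xa]; exists (Ball d e x) => //.
exact: ball_lt_concentric.
Qed.

End BallUniform.

(** * The localic completion: its completeness and the isomorphism *)

Section LocalicCover.
Variables (X : gus) (symX : gus_symmetric X).
Implicit Types (a b c : ball X) (d : gus_metric X) (e : {posnum rat}).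

Let L := localic_completion X.

Lemma localic_cov_small a d e :
  ft_cov (f := L) a [set c | exists2 x, c = Ball d e x & meets c a].
Proof.
apply: (cov_small (ft_pre L) (ft_covP L)) => [b c|b d' e'].
  exact: ball_le_std.
exact/gen_ax/localic_U2.
Qed.

Lemma localic_cov_lt a : ft_cov (f := L) a [set b | ball_lt b a].
Proof. exact/gen_ax/localic_U1. Qed.

(** The map [<] carries localic covers into the completion. There [a] is covered by balls [c < b]
    with [b] in [uc a]; since [b] is localically covered by [a], hence by [U], the map covers [c] by
    balls [<] members of [U]. *)
Lemma localic_complete : complete (localic_uft symX).
Proof.
apply/completeP => a U; split; last exact: completion_cov_sub.
move=> aU.
have ltP := is_ft_map_completion_lt symX
  (@localic_cov_std X) (localic_positivity X) (localic_uniformity symX).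
apply: (ft_trans (completion_lt_uc symX (fun _ _ h => h) (@localic_cov_std X)
  (localic_positivity X) (localic_uniformity symX) a)).
move=> c [b cb ab].
have bU : ft_cov (f := L) b U.
  apply: (@ft_trans L _ _ _ (uc_cov (fun _ _ h => h) (@localic_cov_std X)
    (localic_uniformity symX) ab)) => _ -> //.
apply: (ft_trans (ftm_cov ltP bU _)); first by exists b.
move=> f [u Uu /ball_ltW fu].
apply: (@ft_sub (completion (localic_uft symX)) [set u]) => [|_ -> //].
(* The outer [gen_le] is for the order of the completion, which is the localic cover by a singleton;
   the inner one is for [ball_le]. *)
exact/gen_le/gen_le.
Qed.

Let C : formal_topology := completion (std_uft symX).
Let ucX : set (set (ball X)) := @ball_covers X.
Let std_uc (a : ball X) : set (ball X) := uc (S := std_ft X) setT ucX a.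
Let uc_rel (a b : ball X) : Prop := std_uc b a.

Lemma std_ucP a b : std_uc a b <-> exists d e, forall x,
  meets (Ball d e x) b -> std_le (Ball d e x) a.
Proof.
have ucE := uc_ballP (std_le_pre X) (ft_covP (std_ft X)) (@ball_le_std X)
  (fun a U (h : std_cov a U) => h) a b.
split=> [/ucE[d [e he]]|[d [e he]]]; first by exists d, e => x /he/cov1_std; apply.
by apply/ucE; exists d, e => x /he xa y /xa; exists a.
Qed.

Lemma ball_lt_std_uc a b : ball_lt a b -> std_uc b a.
Proof.
exact: (ball_lt_uc symX (std_le_pre X) (ft_covP (std_ft X)) (@ball_le_std X)).
Qed.

Lemma localic_cov_uc a d e (V : set (ball X)) :
  (forall x, meets (Ball d e x) a ->
     exists2 b, V b & ball_lt (Ball d e x) b) ->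
  ft_cov (f := L) a (relpre uc_rel V).
Proof.
move=> hV; apply: (ft_sub (localic_cov_small a d e)) => _ [x -> /hV[b Vb xb]].
exists b => //; exact: ball_lt_std_uc.
Qed.

Lemma std_uc_le a b : std_uc a b -> std_le b a.
Proof.
move=> /std_ucP[d [e he]] x bx.
have xx := ball_center_pts (Ball d e x).
by apply: (he x) => //; exists x.
Qed.

Lemma std_uc_down a b c : ball_le c b -> std_uc a b -> std_uc a c.
Proof.
move=> /ball_le_std cb /std_ucP[d [e he]]; apply/std_ucP; exists d, e.
by move=> x [z [xz /cb bz]]; apply: he; exists z.
Qed.

(** Induction on the generated cover. The order of [C] is inclusion of points, under which [std_uc]
    is monotone; the axiom for [uc] follows from [small_meets_uc], the one for uniform covers by
    halving the radius. *)
Lemma is_ft_map_std_uc :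
  is_ft_map (S := L) (T := C) uc_rel.
Proof.
have downE (a b : ball X) : ft_setcov (S := L)
    (ft_down (S := L) (relpre uc_rel [set a])
                     (relpre uc_rel [set b]))
    (relpre uc_rel (ft_down (S := C) [set a] [set b])).
  move=> c [a' [b' [[_ -> aa'] [_ -> bb']]]].
  move=> /std_uc_down/(_ aa') /std_ucP[d1 [e1 h1]].
  move=> /std_uc_down/(_ bb') /std_ucP[d2 [e2 h2]].
  have [d [d1d d2d]] := gus_metric_ub d1 d2.
  have [e [ee1 ee2]] := posnum_lb e1 e2; have [h hE] := posnum_half e.
  have he : h%:num < e%:num by rewrite -hE ltrDl.
  (* A ball of radius [h] meeting [c] is [<] the concentric one of radius [e], whose points lie in
     both [a] and [b]. *)
  apply: (@localic_cov_uc c d h) => x [z [xz cz]].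
  have xlt := ball_lt_concentric d x he; exists (Ball d e x) => //.
  have ez := ball_le_std (ball_ltW xlt) xz.
  have le1 := ball_le_std (ball_le_center x d1d ee1).
  have le2 := ball_le_std (ball_le_center x d2d ee2).
  exists a, b; split=> // y ye; [exists a|exists b] => //.
    by apply: (h1 x); [exists z; split=> //; apply: le1|apply: le1].
  by apply: (h2 x); [exists z; split=> //; apply: le2|apply: le2].
split=> //.
- move=> a _; apply: ft_sub (localic_cov_lt a) _ => b ba.
  by exists a => //; exact: ball_lt_std_uc.
- apply: (@gen_cov_least _ _ _ (fun a U => ft_setcov (S := L)
    (relpre uc_rel [set a])
    (relpre uc_rel U))); first split.
  + by move=> U a Ua b [_ -> ba]; apply: ft_refl; exists a.
  + move=> a U V aU UV b ba; apply: ft_trans (aU b ba) _ => c [u Uu cu].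
    by apply: (UV u Uu); exists u.
  + move=> a U V aU aV b ba.
    apply: (ft_trans (cov_down (ft_covP L) (aU b ba) (aV b ba))).
    move=> c [u' [v' [[u Uu uu] [v Vv vv] cu cv]]].
    apply: (ft_sub (downE u v c _)).
      by exists u', v'; split=> //; [exists u|exists v].
    by move=> w [t [_ [_ [-> -> tu tv]]] wt]; exists t => //; exists u, v.
  + move=> a b ab c [_ -> /std_ucP[d [e he]]]; apply: ft_refl; exists b => //.
    by apply/std_ucP; exists d, e => x /he xa y /xa /ab[_ ->].
  + move=> a _ [{}a|{}a _ [d [e ->]]|{}a] b [_ -> ab].
    * have [d [e [h [he hb]]]] := small_meets_uc symX (@ball_le_std X)
        (fun a U (h : std_cov a U) => h) ab.
      apply: (@localic_cov_uc b d h) => x /hb ax; exists (Ball d e x) => //.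
      exact: ball_lt_concentric.
    * have [h hE] := posnum_half e.
      apply: (@localic_cov_uc b d h) => x _; exists (Ball d e x).
        by exists x.
      by apply: ball_lt_concentric; rewrite -hE ltrDl.
    * by apply: ft_refl; exists a.
Qed.

Lemma completion_localic_iso : ft_isomorphic C L.
Proof.
pose r : ft_map C L := FtMap (is_ft_map_completion_lt symX
  (fun a U (h : std_cov a U) => h) (std_positivity X) (std_uniformity symX)).
pose s : ft_map L C := FtMap is_ft_map_std_uc.
exists r, s; split=> a; split.
(* On [C], inclusion of the points of [c] in those of [a] already is the order. *)
- move=> c [_ -> [b /ball_ltW/ball_le_std cb /std_uc_le ba]].
  apply: (@ft_sub C [set a]) => [|_ ->]; last by exists a.
  by apply: gen_le => x /cb/ba; exists a.
- move=> _ [_ -> ->].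
  apply: ft_sub (completion_lt_uc symX (@ball_le_std X)
    (fun a U (h : std_cov a U) => h) (std_positivity X) (std_uniformity symX) a) _.
  by move=> c [b cb ab]; exists a => //; exists b.
(* On [L], inclusion of points is not enough; the strict step [b < a] makes small balls meeting [c],
   hence [b], formally [<] [a]. *)
- move=> c [_ -> [b /std_uc_le cb ba]]; have [e he] := small_meets_lt symX ba.
  apply: (@ft_trans L _ _ _ (localic_cov_small c (ball_metric b) e)).
  move=> _ [x -> [z [xz /cb bz]]].
  apply: (@ft_sub L [set a]) => [|_ ->]; last by exists a.
  by apply/gen_le/ball_ltW/he => //; [exact: gm_lexx|exists z].
- move=> _ [_ -> ->]; apply: ft_sub (localic_cov_lt a) _ => b ba.
  have [c bc ca] := ball_lt_interpolate ba; exists a => //; exists c => //.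
  exact: ball_lt_std_uc.
Qed.

End LocalicCover.

Theorem theorem5p5 (X : gus) (symX : gus_symmetric X) :
  ft_isomorphic (completion (std_uft symX)) (localic_completion X) /\
  complete (localic_uft symX).
Proof. by split; [exact: completion_localic_iso|exact: localic_complete]. Qed.
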